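(* Let $\mathfrak{B}$ be a bornology with a closed base on a topological space $X$. If $X$ satisfies $U_{fin}(\Gamma_{\mathfrak{B}},\Gamma)$, then $X$ satisfies $S_{fin}(\Gamma_{\mathfrak{B}},\Omega)$.
   Context: A bornology $\mathfrak{B}$ on $X$ is a family of subsets of $X$ that is closed under taking subsets and finite unions and covers $X$; by standing convention $X\notin\mathfrak{B}$. A base of $\mathfrak{B}$ is a subfamily $\mathfrak{B}_0\subseteq\mathfrak{B}$ such that every $B\in\mathfrak{B}$ is contained in some $B_0\in\mathfrak{B}_0$; it is closed if its members are closed subsets of $X$. $\Gamma_{\mathfrak{B}}$ is the collection of all $\gamma_{\mathfrak{B}}$-covers of $X$: infinite covers $\mathcal{U}=\{U_n:n\in\omega\}$ of $X$ by proper open subsets such that for each $B\in\mathfrak{B}$ there is $n_0\in\omega$ with $B\subseteq U_n$ for all $n\ge n_0$. $\Gamma$ is the collection of all $\gamma$-covers of $X$: infinite open covers $\mathcal{U}$ such that for each $x\in X$ the set $\{U\in\mathcal{U}:x\notin U\}$ is finite. $\Omega$ is the collection of all $\omega$-covers of $X$: open covers $\mathcal{U}$ with $X\notin\mathcal{U}$ such that every finite $F\subseteq X$ is contained in some $U\in\mathcal{U}$. For collections $\mathcal{A},\mathcal{B}$ of families of subsets of $X$: $S_{fin}(\mathcal{A},\mathcal{B})$ means that for each sequence $\{\mathcal{U}_n:n\in\omega\}$ of elements of $\mathcal{A}$ there are finite (possibly empty) $\mathcal{V}_n\subseteq\mathcal{U}_n$ with $\bigcup_{n\in\omega}\mathcal{V}_n\in\mathcal{B}$.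 $U_{fin}(\mathcal{A},\mathcal{B})$ means that for each such sequence there are finite (possibly empty) $\mathcal{V}_n\subseteq\mathcal{U}_n$ such that $\{\bigcup\mathcal{V}_n:n\in\omega\}\in\mathcal{B}$ or $\bigcup\mathcal{V}_n=X$ for some $n$. *)

(* Defs.v *)
From HB Require Import structures.
From mathcomp Require Import all_boot all_order all_algebra.
From mathcomp Require Import all_classical all_reals all_analysis.

Set Implicit Arguments.
Unset Strict Implicit.
Unset Printing Implicit Defensive.

Local Open Scope classical_set_scope.

(* Closure under binary unions: for a nonempty X this is closure under all
   finite unions, because B covers X and so contains set0. The clause
   ~ B setT is the convention that X itself is never bounded. *)
Definition bornology (X : Type) (B : set (set X)) : Prop :=
  [/\ forall A C : set X, B A -> C `<=` A -> B C,
      forall A C : set X, B A -> B C -> B (A `|` C),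
      \bigcup_(A in B) A = [set: X]
    & ~ B [set: X]].

Definition bornology_base (X : Type) (B B0 : set (set X)) : Prop :=
  B0 `<=` B /\ forall A : set X, B A -> exists2 A0 : set X, B0 A0 & A `<=` A0.

Definition has_closed_base (X : topologicalType) (B : set (set X)) : Prop :=
  exists2 B0 : set (set X),
    bornology_base B B0 & forall A : set X, B0 A -> closed A.

Definition open_cover (X : topologicalType) (U : set (set X)) : Prop :=
  (forall O : set X, U O -> open O) /\ \bigcup_(O in U) O = [set: X].

(* The enumeration u may repeat members; what is required to be infinite is
   the family U itself. *)
Definition GammaB (X : topologicalType) (B : set (set X)) :
    set (set (set X)) :=
  [set U | [/\ infinite_set U, open_cover U, ~ U [set: X]
    & exists2 u : nat -> set X, U = range u &
        forall A : set X, B A ->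
          exists n0 : nat, forall n : nat, (n0 <= n)%N -> A `<=` u n]].

Definition Gamma (X : topologicalType) : set (set (set X)) :=
  [set U | [/\ infinite_set U, open_cover U
    & forall x : X, finite_set [set O | U O /\ ~ O x]]].

Definition Omega (X : topologicalType) : set (set (set X)) :=
  [set U | [/\ open_cover U, ~ U [set: X]
    & forall F : set X, finite_set F -> exists2 O : set X, U O & F `<=` O]].

Definition S_fin (X : Type) (A B : set (set (set X))) : Prop :=
  forall U : nat -> set (set X), (forall n, A (U n)) ->
    exists V : nat -> set (set X),
      (forall n, finite_set (V n) /\ V n `<=` U n) /\ B (\bigcup_n V n).

Definition U_fin (X : Type) (A B : set (set (set X))) : Prop :=
  forall U : nat -> set (set X), (forall n, A (U n)) ->
    exists V : nat -> set (set X),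
      (forall n, finite_set (V n) /\ V n `<=` U n) /\
      (B (range (fun n => \bigcup_(O in V n) O)) \/
       exists n, \bigcup_(O in V n) O = [set: X]).

(* Main.v *)
Require Import Defs.
From mathcomp Require Import all_boot all_order all_algebra.
From mathcomp Require Import all_classical all_reals all_analysis.

Local Open Scope classical_set_scope.

(** Write the n-th given cover as a sequence u n 0, u n 1, ... .  The first step
    extracts from U_fin(Gamma_B, Gamma) bounds g n k such that every point x
    satisfies, for almost all n and for every k at once,

      x \in u n m for some m in the block [k, k + g n k]

    ([U_fin_point_in_blocks]).  To get the bounds for all k, the property is
    applied to the covers whose m-th member is the intersection of the u n (m + k)
    for n, k <= j.

    Finite sets are then caught by induction on their size
    ([U_fin_seq_in_blocks]).  Suppose that g works for sets of size p.  Since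
    finite intersections further and further out still swallow every bounded set,
    the block intersections v n k, the intersection of the u n m for m in
    [k, k + g n k], are again covers of the same kind, and the first step applies
    to them.  Hence, for almost all n, a further point x lies in some v n k' with
    k' not far beyond k, so x belongs to every u n m of the block of k', and one of
    these contains the p points handled already.

    Thus each size p has its own bounds g p n k, valid for almost all n, and a
    diagonal choice finishes: from the n-th cover take the u n m with m at most
    g p n 0 for some p <= n. *)

Lemma leq_bigmax_lt (F : nat -> nat) (n i : nat) :
  (i < n)%N -> (F i <= \max_(j < n) F j)%N.
Proof. by move=> ltin; exact: (leq_bigmax (Ordinal ltin)). Qed.

(** The form in which finiteness is used below: thresholds attached to the
    members of a finite set can be chosen uniformly. *)
Lemma finite_set_uniform_bound (T : Type) (A : set T) (P : T -> nat -> Prop) :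
  finite_set A -> (forall x, A x -> exists n, P x n) ->
  (forall x m n, P x m -> (m <= n)%N -> P x n) ->
  exists N, forall x, A x -> P x N.
Proof.
move=> finA exP monoP.
have /choice[f fP] x : exists n, A x -> P x n.
  by have [/exP[n Pn]|nA] := pselect (A x); [exists n|exists 0%N].
have /finite_seqP[s fAs] := finite_image f finA.
exists (\max_(i <- s) i)%N => x Ax.
have fxs : f x \in s by have : (f @` A) (f x) by [exists x]; rewrite fAs.
apply: monoP (fP x Ax) _; exact: leq_bigmax_seq.
Qed.

Section GammaSequences.
Variables (X : topologicalType) (B : set (set X)).
Hypothesis hB : bornology B.

(** The enumerations of the gamma_B-covers.  That the range is infinite and
    covers the space follows, see [gamma_seq_range]. *)
Definition gamma_seq (w : nat -> set X) : Prop :=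
  [/\ forall m, open (w m), forall m, w m <> [set: X]
    & forall A, B A -> exists n0, forall m, (n0 <= m)%N -> A `<=` w m].

Lemma gamma_seq_point {w : nat -> set X} (x : X) :
  gamma_seq w -> exists n0, forall m, (n0 <= m)%N -> w m x.
Proof.
case=> _ _ ev; case: hB => _ _ covB _.
have [A BA Ax] : (\bigcup_(A in B) A) x by rewrite covB.
by have [n0 n0P] := ev A BA; exists n0 => m /n0P; apply.
Qed.

(** A proper subset misses some point, and almost all members contain that
    point, so that no member is repeated infinitely often. *)
Lemma gamma_seq_range (w : nat -> set X) :
  gamma_seq w -> GammaB B (range w).
Proof.
move=> gw; have [wo wp ev] := gw; split.
- move=> fin.
  have [||N NP] := @finite_set_uniform_bound _ (range w)
    (fun C N => forall m, (N <= m)%N -> w m <> C) fin.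
  + move=> C [m _ <-]; have /existsNP[x nx] : ~ forall x, w m x.
      by move=> all; apply: (wp m); apply/seteqP; split => // x _; apply: all.
    have [n0 n0P] := gamma_seq_point x gw.
    by exists n0 => k /n0P wkx wE; apply: nx; rewrite -wE.
  + by move=> C m n mP mn k nk; apply: mP; apply: leq_trans nk.
  + by apply: (NP (w N) _ N (leqnn N)) => //; exists N.
- split=> [C [m _ <-]|]; first exact: wo.
  apply/seteqP; split=> // x _; have [n0 n0P] := gamma_seq_point x gw.
  by exists (w n0); [exists n0|exact: n0P].
- by case=> m _; exact: wp.
- by exists w.
Qed.

Lemma gamma_seq_bigcap (h : nat -> nat) (f : nat -> nat -> set X) :
  (forall i m, open (f i m)) -> (forall m, f 0%N m <> [set: X]) ->
  (forall A, B A -> exists n0, forall m, (n0 <= m)%N ->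
     forall i, (i <= h m)%N -> A `<=` f i m) ->
  gamma_seq (fun m => \bigcap_(i < (h m).+1) f i m).
Proof.
move=> fo fp ev; split=> [m|m capT|A BA].
- by rewrite bigcap_mkord; elim/big_ind: _ => //; [exact: openT|exact: openI].
- apply: (fp m); apply/seteqP; split=> // x _.
  have : (\bigcap_(i < (h m).+1) f i m) x by rewrite capT.
  exact.
- have [n0 n0P] := ev A BA.
  by exists n0 => m mn x Ax i /= ih; apply: n0P Ax.
Qed.

Lemma gamma_seq_block (h : nat -> nat) (w : nat -> set X) :
  gamma_seq w -> gamma_seq (fun m => \bigcap_(i < (h m).+1) w (m + i)%N).
Proof.
case=> wo wp ev.
apply: (@gamma_seq_bigcap h (fun i m => w (m + i)%N)) => // A BA.
have [n0 n0P] := ev A BA; exists n0 => m mn i _; apply: n0P.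
exact: leq_trans (leq_addr _ _).
Qed.

Lemma gamma_seq_meet (j : nat) (f : nat -> nat -> set X) :
  (forall i, gamma_seq (f i)) -> gamma_seq (fun m => \bigcap_(i < j.+1) f i m).
Proof.
move=> gf; apply: (@gamma_seq_bigcap (fun=> j)) => [i m|m|A BA].
- by case: (gf i).
- by case: (gf 0%N).
have [||N NP] := @finite_set_uniform_bound _ `I_j.+1
  (fun i N => forall m, (N <= m)%N -> A `<=` f i m) (finite_II _).
- by move=> i _; case: (gf i) => _ _; apply.
- by move=> i m n mP mn k nk; apply: mP; apply: leq_trans nk.
- by exists N => m Nm i ij; apply: NP.
Qed.

Hypothesis hU : U_fin (GammaB B) (@Gamma X).

(** Membership in Gamma only says that a point misses finitely many of the finite
    unions as sets, and one union may occur for infinitely many indices.  So index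
    n is served by an index j >= n whose union does not occur before n: a given
    union then serves finitely many n.  Monotonicity transports the selection
    from the j-th cover back to the n-th one. *)
Lemma U_fin_point_decreasing (w : nat -> nat -> set X) :
  (forall n, gamma_seq (w n)) ->
  (forall i j m, (i <= j)%N -> w j m `<=` w i m) ->
  exists g : nat -> nat, forall x, exists N, forall n, (N <= n)%N ->
    exists2 m, (m <= g n)%N & w n m x.
Proof.
move=> gw dec.
have [fincov|] := pselect (forall n, exists M, forall x,
    exists2 m, (m <= M)%N & w n m x).
  by have [g gP] := choice fincov; exists g => x; exists 0%N => n _; apply: gP.
(* A cover with a finite subcover would make the second alternative of U_fin
   uninformative; past n0, by monotonicity, there is none. *)
move=> /existsNP[n0 nocov].
have [V [Vfin VP]] := hU (fun n => range (w (n0 + n)%N))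
  (fun n => @gamma_seq_range _ (gw _)).
have exM n : exists M, forall C, V n C ->
    exists2 m, (m <= M)%N & C = w (n0 + n)%N m.
  have [finV Vsub] := Vfin n.
  apply: finite_set_uniform_bound => [//|C /Vsub[m _ <-]|C m k [i im ->] mk].
  - by exists m, m.
  - by exists i => //; apply: leq_trans mk.
have [M MP] := choice exM.
have DM n x : (\bigcup_(C in V n) C) x ->
    exists2 m, (m <= M n)%N & w (n0 + n)%N m x.
  by case=> C /MP[m mM ->] wx; exists m.
case: VP => [[infD _ finD]|[n Dn]]; last first.
  exfalso; apply: nocov; exists (M n) => x.
  have /DM[m mM wx] : (\bigcup_(C in V n) C) x by rewrite Dn.
  by exists m => //; apply: dec wx; apply: leq_addr.
set D := fun n => \bigcup_(C in V n) C.
have exj n : exists j, forall i, (i < n)%N -> D j <> D i.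
  apply: contrapT => /forallNP old; apply: infD.
  apply: (@sub_finite_set _ _ (D @` `I_n)); last exact/finite_image/finite_II.
  move=> _ [j _ <-].
  by have /existsNP[i /not_implyP[ilt /contrapT Dji]] := old j; exists i.
have [j jP] := choice exj.
exists (fun n => M (j n)) => x.
have [||N NP] := @finite_set_uniform_bound _ [set C | range D C /\ ~ C x]
  (fun C N => exists2 i, (i <= N)%N & C = D i) (finD x).
- by move=> C [[i _ <-] _]; exists i, i.
- by move=> C m k [i im ->] mk; exists i => //; apply: leq_trans mk.
exists N.+1 => n Nn.
have /DM[m mM wx] : D (j n) x.
  apply: contrapT => nDx; have [|i iN Dj] := NP (D (j n)); first by split.
  by apply: (jP n i) Dj; apply: leq_ltn_trans Nn.
exists m => //; apply: dec wx; apply: leq_trans (leq_addl _ _).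
by rewrite leqNgt; apply/negP => jn; apply: (jP n (j n) jn).
Qed.

(** The j-th auxiliary cover sees u n shifted by k for all n, k <= j, so its bound
    at j = n + k serves the block of u n that starts at k. *)
Lemma U_fin_point_in_blocks (u : nat -> nat -> set X) :
  (forall n, gamma_seq (u n)) ->
  exists g : nat -> nat -> nat, forall x, exists N, forall n, (N <= n)%N ->
    forall k, exists2 i, (i <= g n k)%N & u n (k + i)%N x.
Proof.
move=> gu.
have [||g gP] := @U_fin_point_decreasing
  (fun j m => \bigcap_(n < j.+1) \bigcap_(k < j.+1) u n (m + k)%N).
- by move=> j; apply: gamma_seq_meet => n; exact: (@gamma_seq_block (fun=> j)).
- move=> i j m ij x wx n /= ni k /= ki.
  by apply: wx; apply: leq_trans (ij : (i.+1 <= j.+1)%N).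
exists (fun n k => g (n + k)%N) => x; have [N NP] := gP x.
exists N => n Nn k; have [|m mg wx] := NP (n + k)%N.
  exact: leq_trans (leq_addr _ _).
exists m => //; rewrite addnC; apply: wx => /=.
- by rewrite ltnS leq_addr.
- by rewrite ltnS leq_addl.
Qed.

(** The new point is placed in a whole block of the previous stage, and that
    block has a member that contains all the other points. *)
Lemma U_fin_seq_in_blocks (u : nat -> nat -> set X) :
  (forall n, gamma_seq (u n)) -> forall p,
  exists g : nat -> nat -> nat, forall s : seq X, (size s <= p)%N ->
    exists N, forall n, (N <= n)%N -> forall k,
      exists2 i, (i <= g n k)%N & [set` s] `<=` u n (k + i)%N.
Proof.
move=> gu; elim=> [|p [g gP]].
  by exists (fun _ _ => 0%N) => -[|//] _; exists 0%N => n _ k; exists 0%N.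
have [|h hP] := @U_fin_point_in_blocks
  (fun n k => \bigcap_(i < (g n k).+1) u n (k + i)%N).
  by move=> n; apply: gamma_seq_block.
exists (fun n k => h n k + \max_(i < (h n k).+1) g n (k + i))%N.
case=> [_|x s /= sp]; first by exists 0%N => n _ k; exists 0%N.
have [N1 N1P] := hP x; have [N2 N2P] := gP s sp.
exists (maxn N1 N2) => n; rewrite geq_max => /andP[N1n N2n] k.
have [i ih vx] := N1P n N1n k.
have [i' i'g us] := N2P n N2n (k + i)%N.
exists (i + i')%N.
  apply: (leq_add ih (leq_trans i'g _)).
  exact: (@leq_bigmax_lt (fun i => g n (k + i)%N)).
rewrite addnA => y /=; rewrite inE => /orP[/eqP ->|ys]; last exact: us.
exact: vx.
Qed.

End GammaSequences.

Theorem theorem3p14 (X : topologicalType) (B : set (set X))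
    (hB : bornology B) (hbase : has_closed_base B) :
  U_fin (GammaB B) (@Gamma X) -> S_fin (GammaB B) (@Omega X).
Proof.
move=> hU U UG.
have exu n : exists u : nat -> set X, U n = range u /\ gamma_seq X B u.
  have [_ [Uo _] UT [u Uu ev]] := UG n; exists u; split=> //; split=> // m.
  - by apply: Uo; rewrite Uu; exists m.
  - by move=> um; apply: UT; rewrite Uu; exists m.
have [u uP] := choice exu.
have [|g gP] := choice (@U_fin_seq_in_blocks X B hB hU u _).
  by move=> n; case: (uP n).
pose V n := u n @` `I_(\max_(p < n.+1) g p n 0%N).+1.
have VU n : V n `<=` U n.
  by case: (uP n) => -> _ _ [m _ <-]; exists m.
have VF (F : set X) : finite_set F -> exists2 C, (\bigcup_n V n) C & F `<=` C.
  move=> /finite_seqP[s ->]; have [N NP] := gP _ s (leqnn _).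
  pose n := maxn N (size s).
  have [i ig sub] := NP n (leq_maxl _ _) 0%N.
  exists (u n i) => //; exists n => //; exists i => //=.
  rewrite ltnS; apply: leq_trans ig _.
  by apply: (@leq_bigmax_lt (fun p => g p n 0%N)); rewrite ltnS leq_maxr.
exists V; split=> [n|]; first by split=> //; exact/finite_image/finite_II.
split=> //.
- split=> [C [n _ /VU UC]|]; first by have [_ [Uo _] _ _] := UG n; exact: Uo.
  apply/seteqP; split=> // x _.
  by have [C VC xO] := VF [set x] (finite_set1 x); exists C => //; exact: xO.
- by case=> n _ /VU; case: (UG n).
Qed.
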